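(* Let $\langle T,\bar\mu\rangle$ be a probability tree such that the measure $\lambda^{\bar\mu}$ on $\mathcal B([T])$ is free. Then the cardinal invariants associated with $\mathcal N(\lambda^{\bar\mu})$ and with $\mathcal N([0,1])$ are the same, i.e. $$\mathrm{add}(\mathcal N(\lambda^{\bar\mu}))=\mathrm{add}(\mathcal N([0,1])),\quad \mathrm{cov}(\mathcal N(\lambda^{\bar\mu}))=\mathrm{cov}(\mathcal N([0,1])),$$ $$\mathrm{non}(\mathcal N(\lambda^{\bar\mu}))=\mathrm{non}(\mathcal N([0,1])),\quad \mathrm{cof}(\mathcal N(\lambda^{\bar\mu}))=\mathrm{cof}(\mathcal N([0,1])).$$
   Context: A tree (of sequences) is a non-empty set $T$ of finite sequences with entries in some set, closed under initial segments and ordered by $s\subseteq t$ ($t$ extends $s$); its root is the empty sequence $\langle\,\rangle$. $\mathrm{succ}_T(t)$ is the set of $t'\in T$ extending $t$ with $|t'|=|t|+1$; $\max T$ is the set of $t\in T$ with $\mathrm{succ}_T(t)=\emptyset$; $\lim T$ is the set of infinite sequences $x$ (indexed by $\omega$) with $x\upharpoonright n\in T$ for all $n<\omega$; $[T]=\lim T\cup\max T$, with the topology generated by the sets $[t]_T=\{x\in[T] : t\subseteq x\}$, $t\in T$. A probability tree is a pair $\langle T,\bar\mu\rangle$ where $T$ is a countable tree of sequences and $\bar\mu=\langle\mu_t : t\in T\smallsetminus\max T\rangle$ with each $\mu_t$ a probability measure on the power set of $\mathrm{succ}_T(t)$. $\lambda^{\bar\mu}$ is the unique probability measure on the Borel $\sigma$-algebra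 $\mathcal B([T])$ such that $\lambda^{\bar\mu}([t]_T)=\prod_{k<|t|}\mu_{t\upharpoonright k}(\{t\upharpoonright(k+1)\})$ for all $t\in T$. A measure is free if every singleton is measurable with measure $0$. For a measure $\mu$ on a $\sigma$-algebra $\mathcal A$ over $X$, $\mathcal N(\mu)=\{N\subseteq X : \exists A\in\mathcal A\ (N\subseteq A,\ \mu(A)=0)\}$; $\mathcal N([0,1])$ is the ideal of Lebesgue null subsets of $[0,1]$. For an ideal $\mathcal I$ on a set $X$: $\mathrm{add}(\mathcal I)=\min\{|\mathcal F| : \mathcal F\subseteq\mathcal I,\ \bigcup\mathcal F\notin\mathcal I\}$, $\mathrm{cov}(\mathcal I)=\min\{|\mathcal F| : \mathcal F\subseteq\mathcal I,\ \bigcup\mathcal F=X\}$, $\mathrm{non}(\mathcal I)=\min\{|Y| : Y\subseteq X,\ Y\notin\mathcal I\}$, $\mathrm{cof}(\mathcal I)=\min\{|\mathcal F| : \mathcal F\subseteq\mathcal I,\ \forall A\in\mathcal I\ \exists B\in\mathcal F\ (A\subseteq B)\}$. *)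

(* Defs.v *)
From HB Require Import structures.
From mathcomp Require Import all_boot all_order all_algebra.
From mathcomp Require Import all_classical all_reals all_analysis.

Set Implicit Arguments.
Unset Strict Implicit.
Unset Printing Implicit Defensive.

Import Order.TTheory GRing.Theory Num.Theory.

Local Open Scope classical_set_scope.
Local Open Scope card_scope.

(* A cardinal is represented by the class of all types of that cardinality;
   by [cardinality_eqP], equality of cardinals is then Leibniz equality. *)
Definition cardinal := Type -> Prop.

Definition cardinality (U : Type) (A : set U) : cardinal :=
  fun K => [set: K] #= A.

Lemma cardinality_eqP (U V : Type) (A : set U) (B : set V) :
  cardinality A = cardinality B <-> A #= B.
Proof.
split=> [AB|AB].
  have : cardinality A (set_type A) := card_setT A.
  by rewrite AB => /(card_eq_trans (card_setT_sym A)).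
apply/funext => K; apply/propext; split=> KA; apply: card_eq_trans KA _ => //.
exact: card_esym.
Qed.

(* min { |A| : A in C }, for a nonempty class C of sets; see
   [min_cardinalityP]. *)
Definition min_cardinality (U : Type) (C : set (set U)) : cardinal :=
  fun K => exists A, [/\ C A, forall B, C B -> A #<= B & cardinality A K].

Lemma exists_min_cardinality (U : Type) (C : set (set U)) :
  C !=set0 -> exists A, C A /\ forall B, C B -> A #<= B.
Proof.
move=> [A0 CA0].
have [[A [CA A_0]]|nonempty] := pselect (exists A, C A /\ A = set0).
  by exists A; split=> // B _; rewrite A_0 card_ge0.
have CN B : C B -> exists x, B x.
  move=> CB; have [//|nB] := pselect (exists x, B x); case: nonempty.
  by exists B; split=> //; apply/seteqP; split=> // x Bx; case: nB; exists x.
(* Zorn: a maximal family of choice functions that differ pairwise at every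
   member of C *)
pose P (S : set (set U -> U)) :=
  (forall g, S g -> forall B, C B -> B (g B)) /\
  (forall g h, S g -> S h -> forall B, C B -> g B = h B -> g = h).
have [|S [[Sch Sinj] Smax]] := @Zorn_bigcup (set U -> U) P.
  move=> F FP Ftot; split=> [g [X FX Xg]|g h [X FX Xg] [Y FY Yh]].
    exact: (FP _ FX).1.
  have [XY|YX] := Ftot _ _ FX FY.
    exact: (FP _ FY).2 (XY _ Xg) Yh.
  exact: (FP _ FX).2 Xg (YX _ Yh).
have [[A [CA AS]]|nA] :=
    pselect (exists A, C A /\ A `<=` [set g A | g in S]).
  exists A; split=> // B CB.
  apply: (card_le_trans (subset_card_le AS)).
  apply: (card_le_trans (card_image_le (fun g => g A) S)).
  have /card_eqPle[_ SB] : [set g B | g in S] #= S.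
    apply: inj_card_eq => g h; rewrite !inE => Sg Sh; exact: (Sinj g h Sg Sh B CB).
  apply: (card_le_trans SB).
  by apply: subset_card_le => _ [g Sg <-]; exact: (Sch g Sg B CB).
have [x0 _] := CN _ CA0.
have new B : exists x, C B -> B x /\ ~ [set g B | g in S] x.
  have [CB|nCB] := pselect (C B); last by exists x0.
  have [//|nB] := pselect (exists x, C B -> B x /\ ~ [set g B | g in S] x).
  case: nA; exists B; split=> // x Bx.
  by have [//|nx] := pselect ([set g B | g in S] x); case: nB; exists x.
have [h hP] := choice new.
have nSh : ~ S h by move=> Sh; apply: (hP _ CA0).2; exists h.
case: (Smax (S `|` [set h])).
  by split=> [g Sg|/(_ h (or_intror erefl))//]; left.
split=> [g [Sg|->] B CB|g g' [Sg|->] [Sg'|->] B CB //].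
- exact: (Sch g Sg B CB).
- by have [] := hP _ CB.
- exact: (Sinj g g' Sg Sg' B CB).
- by move=> E; case: (hP _ CB).2; exists g.
- by move=> E; case: (hP _ CB).2; exists g'.
Qed.

Lemma min_cardinalityP (U : Type) (C : set (set U)) : C !=set0 ->
  exists A, [/\ C A, forall B, C B -> A #<= B &
                min_cardinality C = cardinality A].
Proof.
move=> /exists_min_cardinality[A [CA Amin]]; exists A; split=> //.
apply/funext => K; apply/propext; split=> [[B [CB Bmin KB]]|KA].
  apply: (card_eq_trans KB); apply/card_eqPle.
  by split; [exact: Bmin|exact: Amin].
by exists A.
Qed.

Section invariants.
(* I is an ideal on the subset X of U *)
Variables (U : Type) (X : set U) (I : set (set U)).

Definition add_ideal : cardinal :=
  min_cardinality [set F : set (set U) | F `<=` I /\ ~ I (\bigcup_(A in F) A)].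

Definition cov_ideal : cardinal :=
  min_cardinality [set F : set (set U) | F `<=` I /\ \bigcup_(A in F) A = X].

Definition non_ideal : cardinal :=
  min_cardinality [set Y : set U | Y `<=` X /\ ~ I Y].

Definition cof_ideal : cardinal :=
  min_cardinality [set F : set (set U) |
    F `<=` I /\ forall A, I A -> exists2 B, F B & A `<=` B].

End invariants.

Definition null_ideal d (T : measurableType d) (R : realType)
  (mu : set T -> \bar R) : set (set T) := [set N | mu.-negligible N].

Definition unit_interval (R : realType) : set R := `[0%R, 1%R].
Arguments unit_interval : clear implicits.

(* Borel and Lebesgue measure on the line have the same negligible sets, as
   negligible sets need only be included in measurable sets of measure 0. *)
Definition null_ideal01 (R : realType) : set (set R) :=
  [set N | N `<=` unit_interval R /\ lebesgue_measure.-negligible N].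
Arguments null_ideal01 : clear implicits.

Record tree (A : Type) := Tree {
  nodes : set (seq A) ;
  tree_neq0 : nodes !=set0 ;
  tree_prefix : forall s t : seq A, nodes (s ++ t) -> nodes s }.

Section trees.
Variables (A : Type) (T : tree A).

Definition succ (t : seq A) : set (seq A) :=
  [set t' | [/\ nodes T t', exists u, t' = t ++ u & size t' = (size t).+1]].

Definition maxT : set (seq A) := [set t | nodes T t /\ succ t = set0].

Definition limT : set (nat -> A) := [set x | forall n, nodes T (mkseq x n)].

(* [T] = max T + lim T: finite branches on the left, infinite on the right *)
Definition branch : set (seq A + (nat -> A)) :=
  [set x | match x with inl s => maxT s | inr f => limT f end].

Definition extends (t : seq A) (x : seq A + (nat -> A)) : Prop :=
  match x with
  | inl s => exists u, s = t ++ u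
  | inr f => mkseq f (size t) = t
  end.

Lemma branch_neq0 : branch !=set0.
Proof.
have [[s ms]|nmax] := pselect (exists s, maxT s); first by exists (inl s).
have [t0 Tt0] := tree_neq0 T.
have T0 : nodes T [::] by apply: (@tree_prefix _ T [::] t0).
have step t : exists a, nodes T t -> nodes T (rcons t a).
  have [Tt|nTt] := pselect (nodes T t); last first.
    have [[a _]|nA] := pselect (exists a : A, True); first by exists a.
    case: nmax; exists [::]; split=> //; apply/seteqP; split=> // -[|a u] [] //.
    by move=> *; case: nA; exists a.
  have [[t' [Tt' [u tu] st']]|nt] := pselect (exists t', succ t t'); last first.
    case: nmax; exists t; split=> //; apply/seteqP; split=> // t' st'.
    by case: nt; exists t'.
  case: u => [|a [|b u]] in tu.
  - by move: st'; rewrite tu cats0 => /n_Sn.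
  - by exists a => _; rewrite -cats1 -tu.
  - by move: st'; rewrite tu size_cat/= -[RHS]addn1 => /addnI.
have [c cP] := choice step.
pose b := fix b n := if n is m.+1 then rcons (b m) (c (b m)) else [::].
exists (inr (fun n => c (b n))) => n.
have -> : mkseq (fun n => c (b n)) n = b n.
  by elim: n => // n IHn; rewrite mkseqS IHn.
by elim: n => //= n IHn; exact: cP.
Qed.

Definition branch_space : Type := set_type branch.

HB.instance Definition _ := gen_eqMixin branch_space.
HB.instance Definition _ := gen_choiceMixin branch_space.

Lemma branch_space_point : branch_space.
Proof. by have /cid[x bx] := branch_neq0; exists x; exact: mem_set. Qed.

HB.instance Definition _ := isPointed.Build branch_space branch_space_point.

Definition cone (t : seq A) : set branch_space := [set x | extends t (val x)].

HB.instance Definition _ := @isSubBaseTopological.Build branch_space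
  (set branch_space) [set cone t | t in nodes T] id.

Definition branch_borel := g_sigma_algebraType (@open branch_space).

Definition nonmax : set (seq A) := nodes T `\` maxT.

(* succ_T(t), for t in T \ max T, equipped with its power set *)
Definition succ_type (t : nonmax) : Type := set_type (succ (val t)).

HB.instance Definition _ t := gen_eqMixin (succ_type t).
HB.instance Definition _ t := gen_choiceMixin (succ_type t).

Lemma succ_type_point (t : nonmax) : succ_type t.
Proof.
have [Tt nmt] := set_mem (valP t).
have /cid[t' st'] : exists t', succ (val t) t'.
  have [//|nt'] := pselect (exists t', succ (val t) t').
  case: nmt; split=> //; apply/seteqP; split=> // t' st'.
  by case: nt'; exists t'.
by exists t'; exact: mem_set.
Qed.

HB.instance Definition _ t := isPointed.Build (succ_type t) (succ_type_point t).
HB.instance Definition _ t := @isMeasurable.Build default_measure_display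
  (succ_type t) discrete_measurable discrete_measurable0
  discrete_measurableC discrete_measurableU.

End trees.

Record prob_tree (A : Type) (R : realType) := ProbTree {
  ptree :> tree A ;
  ptree_countable : countable (nodes ptree) ;
  ptree_mu : forall t : nonmax ptree, probability (succ_type t) R }.

Section prob_trees.
Variables (A : Type) (R : realType) (P : prob_tree A R).

Local Open Scope ereal_scope.

(* mu_s({t}); the junk value 0, for s not in T \ max T, is not used below *)
Definition edge_prob (s t : seq A) : \bar R :=
  if pselect (s \in nonmax P) is left h
  then ptree_mu (exist _ s h) [set u | val u = t] else 0.

(* The clause that characterizes the measure of the probability tree among the
   probability measures on the Borel sets of [T]. *)
Definition tree_measure (lambda : set (branch_borel P) -> \bar R) : Prop :=
  forall t, nodes P t ->
    lambda (cone t) = \prod_(k < size t) edge_prob (take k t) (take k.+1 t).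

End prob_trees.

Definition free_measure d (T : measurableType d) (R : realType)
    (mu : set T -> \bar R) : Prop :=
  forall x : T, measurable [set x] /\ mu [set x] = 0%E.

(* Main.v *)
Require Import Defs.
From HB Require Import structures.
From mathcomp Require Import all_boot all_order all_algebra finmap.
From mathcomp Require Import all_classical all_reals all_analysis.

(* Order the siblings of T by an enumeration of its nodes, and let L t be the
   set of branches lying lexicographically to the left of the cone of t. The
   intervals J t = [lambda (L t), lambda (L t) + lambda [t]) refine one another
   along T, and the intervals of the children of t cover J t by
   sigma-additivity, so each y in [0, 1) determines a branch g y with y in J t
   for all nodes t of g y. Then the preimage of [t] under g is J t, so g maps
   Lebesgue measure on [0, 1) to lambda. As lambda is free, J t shrinks to a
   point along every branch, so f x = sup {lambda (L t) : t an initial segment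
   of x} satisfies f (g y) = y; it follows that g (f x) = x for almost every x.
   The pair (f, g) transports null sets both ways, hence all four invariants. *)

Set Implicit Arguments.
Unset Strict Implicit.
Unset Printing Implicit Defensive.

Import Order.TTheory GRing.Theory Num.Theory.

Local Open Scope classical_set_scope.
Local Open Scope card_scope.

(** * Transfer of the four invariants between two ideals *)

Lemma min_cardinality_le_eq (U V : Type) (C : set (set U)) (D : set (set V)) :
    (forall A, C A -> exists2 B, D B & B #<= A) ->
    (forall B, D B -> exists2 A, C A & A #<= B) ->
  min_cardinality C = min_cardinality D.
Proof.
move=> CD DC; apply/funext => K; apply/propext; split=> -[A [CA Amin KA]].
(* A partner [B] of a minimal [A] is minimal too: any [B'] in [D] lies above some [A'] in [C], so
   [B] is below [A], [A'] and [B'] in turn. Taking [B' = B] gives the equality of cardinals. *)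
- have [B DB BA] := CD _ CA; exists B; split=> //.
    move=> B' /DC[A' /Amin AA' A'B'].
    exact: card_le_trans BA (card_le_trans AA' A'B').
  apply: (card_eq_trans KA); apply/card_eqPle; split=> //.
  have [A' /Amin AA' A'B] := DC _ DB.
  exact: card_le_trans AA' A'B.
- have [B DB BA] := DC _ CA; exists B; split=> //.
    move=> B' /CD[A' /Amin AA' A'B'].
    exact: card_le_trans BA (card_le_trans AA' A'B').
  apply: (card_eq_trans KA); apply/card_eqPle; split=> //.
  have [A' /Amin AA' A'B] := CD _ DB.
  exact: card_le_trans AA' A'B.
Qed.

Definition set_ideal (U : Type) (X : set U) (I : set (set U)) : Prop :=
  [/\ forall A, I A -> A `<=` X, forall A B, A `<=` B -> I B -> I A &
      forall A B, I A -> I B -> I (A `|` B)].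

(** Here [g] is a nonsingular map for which [f] is a left inverse almost everywhere. An isomorphism
    modulo null sets is this condition imposed twice, with [f] and [g] exchanged. *)
Definition ideal_section (U V : Type) (X : set U) (Y : set V)
    (I : set (set U)) (J : set (set V)) (f : U -> V) (g : V -> U) : Prop :=
  [/\ forall y, Y y -> X (g y), forall A, I A -> J (Y `&` g @^-1` A) &
      J (Y `&` [set y | f (g y) <> y])].

Section ideal_transfer.
Variables (U V : Type) (X : set U) (Y : set V).
Variables (I : set (set U)) (J : set (set V)) (f : U -> V) (g : V -> U).
Hypotheses (idI : set_ideal X I) (idJ : set_ideal Y J).
Hypotheses (gP : ideal_section X Y I J f g) (fP : ideal_section Y X J I g f).

Let pull (A : set U) : set V := Y `&` g @^-1` A.

(** If the union of the pulled-back sets were in [J], its preimage under [f] would be in [I].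
    Together with the set where [g (f x) <> x] that preimage covers the union of [F]. *)
Lemma add_ideal_le (F : set (set U)) : F `<=` I /\ ~ I (\bigcup_(A in F) A) ->
  exists2 G : set (set V), G `<=` J /\ ~ J (\bigcup_(B in G) B) & G #<= F.
Proof.
move: idI idJ gP fP => [IX IS IU] [JY JS JU] [gX gI gf] [fY fJ fg].
move=> [FI nF]; exists (pull @` F); last exact: card_image_le.
split=> [_ [A /FI/gI gA <-] //|/fJ/(fun H => IU _ _ H fg) H].
apply: nF; apply: IS H => x [A FA Ax]; have Xx := IX _ (FI _ FA) _ Ax.
have [E|nE] := pselect (g (f x) = x); [left|by right].
split=> //; exists (pull A); first by exists A.
by split; [exact: fY|rewrite /preimage/= E].
Qed.

Lemma cov_ideal_le (F : set (set U)) : F `<=` I /\ \bigcup_(A in F) A = X ->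
  exists2 G : set (set V), G `<=` J /\ \bigcup_(B in G) B = Y & G #<= F.
Proof.
move: gP => [gX gI gf].
move=> [FI FX]; exists (pull @` F); last exact: card_image_le.
split=> [_ [A /FI/gI gA <-] //|].
apply/seteqP; split=> [y [_ [A _ <-] []] //|y Yy].
have := gX _ Yy; rewrite -FX => -[A FA Ay].
by exists (pull A); [exists A|].
Qed.

(** The witness is the image of [Z] under [f]: were it in [J], its preimage under [f], which
    contains [Z], would be in [I]. *)
Lemma non_ideal_le (Z : set U) : Z `<=` X /\ ~ I Z ->
  exists2 W : set V, W `<=` Y /\ ~ J W & W #<= Z.
Proof.
move: idI fP => [IX IS IU] [fY fJ fg].
move=> [ZX nZ]; exists (f @` Z); last exact: card_image_le.
split=> [_ [x /ZX/fY fx <-] //|/fJ H].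
by apply: nZ; apply: IS H => x Zx; split; [exact: ZX|exists x].
Qed.

(** Each pulled-back set is enlarged by the exceptional set [M]. For [B] in [J], choose [A] in [F]
    above the preimage of [B] under [f]; a point [y] of [B] outside [M] has [f (g y) = y], hence
    [g y] in [A]. *)
Lemma cof_ideal_le (F : set (set U)) :
    F `<=` I /\ (forall A, I A -> exists2 B, F B & A `<=` B) ->
  exists2 G : set (set V),
    G `<=` J /\ (forall A, J A -> exists2 B, G B & A `<=` B) & G #<= F.
Proof.
move: idJ gP fP => [JY JS JU] [gX gI gf] [fY fJ fg].
pose M := Y `&` [set y | f (g y) <> y].
move=> [FI Fcof]; exists ((fun A => pull A `|` M) @` F); last exact: card_image_le.
split=> [_ [A /FI/gI gA <-]|B JB]; first exact: JU.
have [A FA BA] := Fcof _ (fJ _ JB).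
exists (pull A `|` M); first by exists A.
move=> y By; have Yy := JY _ JB _ By.
have [E|nE] := pselect (f (g y) = y); [left|by right].
by split=> //; apply: BA; split; [exact: gX|rewrite /preimage/= E].
Qed.

End ideal_transfer.

Lemma ideal_section_invariants (U V : Type) (X : set U) (Y : set V)
    (I : set (set U)) (J : set (set V)) (f : U -> V) (g : V -> U) :
    set_ideal X I -> set_ideal Y J ->
    ideal_section X Y I J f g -> ideal_section Y X J I g f ->
  [/\ add_ideal I = add_ideal J, cov_ideal X I = cov_ideal Y J,
      non_ideal X I = non_ideal Y J & cof_ideal I = cof_ideal J].
Proof.
move=> iI iJ gP fP; split; apply: min_cardinality_le_eq => F HF.
- exact: add_ideal_le gP fP _ HF.
- exact: add_ideal_le fP gP _ HF.
- exact: cov_ideal_le gP _ HF.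
- exact: cov_ideal_le fP _ HF.
- exact: non_ideal_le fP _ HF.
- exact: non_ideal_le gP _ HF.
- exact: cof_ideal_le gP fP _ HF.
- exact: cof_ideal_le fP gP _ HF.
Qed.

(** * Cones and branches of a tree *)

Section cones.
Variables (A : Type) (T : tree A).
Implicit Types (s t u : seq A) (x : branch_space T).
Local Notation cone := (@Defs.cone A T).

Lemma nodes_nil : nodes T [::].
Proof. by have [t Tt] := tree_neq0 T; apply: (@tree_prefix _ T [::] t). Qed.

Lemma succP t t' : succ T t t' <-> nodes T t' /\ exists a, t' = rcons t a.
Proof.
split=> [[Tt' [u E] st]|[Tt' [a E]]]; last first.
  by split=> //; [exists [:: a]; rewrite E cats1|rewrite E size_rcons].
subst t'; case: u => [|a [|b u]] in Tt' st *.
- by move: st; rewrite cats0 => /n_Sn.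
- by move: Tt'; rewrite cats1 => Tta; split; [exact: Tta|exists a].
- by move: st; rewrite size_cat/= -[RHS]addn1 => /addnI.
Qed.

Lemma mkseq_take (g : nat -> A) k n : (k <= n)%N -> take k (mkseq g n) = mkseq g k.
Proof. by move=> kn; rewrite -map_take take_iota (minn_idPl kn). Qed.

Lemma coneT : cone [::] = setT.
Proof.
apply/seteqP; split=> // -[[s|h] p] _; rewrite /cone/=; first by exists s.
by [].
Qed.

Lemma cone_catl t u : cone (t ++ u) `<=` cone t.
Proof.
move=> [[s|h] p]; rewrite /cone/=; first by move=> [v ->]; exists (u ++ v); rewrite catA.
move=> /(congr1 (take (size t))); rewrite take_size_cat//.
by rewrite mkseq_take// size_cat leq_addr.
Qed.

Lemma cone_comparable t u x : cone t x -> cone u x -> (size t <= size u)%N ->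
  exists v, u = t ++ v.
Proof.
case: x => -[s|h] p; rewrite /cone/=.
  move=> [v ->] [w E] tu; exists (drop (size t) u); rewrite -[LHS](cat_take_drop (size t)).
  by move/(congr1 (take (size t))): E; rewrite take_size_cat// takel_cat// => <-.
move=> Et Eu tu; exists (drop (size t) u); rewrite -[LHS](cat_take_drop (size t)).
by rewrite -{1}Eu mkseq_take// Et.
Qed.

Lemma cone_rcons_inj t a b x :
  cone (rcons t a) x -> cone (rcons t b) x -> a = b.
Proof.
move=> ca cb; have := cone_comparable ca cb; rewrite !size_rcons => /(_ (leqnn _))[v].
by rewrite -!cats1 -catA => /(congr1 (drop (size t))); rewrite !drop_size_cat// => -[].
Qed.

Lemma maxT_rcons t a : maxT T t -> ~ nodes T (rcons t a).
Proof.
move=> [Tt s0] Tta; have : succ T t (rcons t a) by apply/succP; split=> //; exists a.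
by rewrite s0.
Qed.

Lemma cone_nodes t x : cone t x -> nodes T t.
Proof.
case: x => -[s|h] p; rewrite /cone/=; have := set_mem p.
  by move=> [Ts _] [u E]; apply: (@tree_prefix _ T _ u); rewrite -E.
by move=> /(_ (size t)) + E; rewrite E.
Qed.

Lemma cone_child t x : ~ maxT T t -> cone t x -> exists a, cone (rcons t a) x.
Proof.
case: x => -[s|h] p nm; rewrite /cone/=; have bp := set_mem p.
  case=> -[|a u] E; first by case: nm; move: E bp; rewrite cats0 => ->.
  by exists a, u; rewrite E -cats1 -catA.
by move=> E; exists (h (size t)); rewrite size_rcons mkseqS E.
Qed.

Lemma cone_maxT t x y : maxT T t -> cone t x -> cone t y -> x = y.
Proof.
move=> mt.
suff H z : cone t z -> val z = inl t.
  by move=> /H xt /H yt; apply: val_inj; rewrite xt yt.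
case: z => -[s|h] p; rewrite /cone/=; have bp := set_mem p.
  case=> -[|a u] E; first by rewrite E cats0.
  case: (maxT_rcons (a := a) mt); apply: (@tree_prefix _ T _ u).
  by rewrite -cats1 -catA/= -E; case: bp.
move=> E; case: (maxT_rcons (a := h (size t)) mt).
by rewrite -{1}E -mkseqS; exact: bp.
Qed.

(** A finite branch is the only point in the cone of its leaf, and an infinite branch is recovered
    entry by entry from its initial segments. *)
Lemma cone_separates x y : (forall t, cone t x <-> cone t y) -> x = y.
Proof.
move=> xy; have [[t [mt tx]]|nm] := pselect (exists t, maxT T t /\ cone t x).
  by apply: (cone_maxT mt tx); apply/xy.
case: x y xy nm => -[s|h] p [[s'|h'] p'] xy nm.
- by case: nm; exists s; split; [exact: set_mem p|exists [::]; rewrite cats0].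
- by case: nm; exists s; split; [exact: set_mem p|exists [::]; rewrite cats0].
- case: nm; exists s'; split; [exact: set_mem p'|apply/xy].
  by exists [::]; rewrite cats0.
- apply: val_inj => /=; congr inr; apply/funext => n.
  have hh' : mkseq h' (size (mkseq h n.+1)) = mkseq h n.+1.
    apply: (xy (mkseq h n.+1)).1; change (mkseq h (size (mkseq h n.+1)) = mkseq h n.+1).
    by rewrite size_mkseq.
  move: hh'; rewrite size_mkseq => /(congr1 (fun s => nth (h n) s n)).
  by rewrite !nth_mkseq.
Qed.

(** Dependent choice along the tree: the recursion either meets a leaf or runs through all lengths.
    It will be applied to the nodes whose interval contains a given real. *)
Lemma exists_branch (Q : set (seq A)) : Q [::] ->
    (forall t, nodes T t -> ~ maxT T t -> Q t ->
      exists2 a, nodes T (rcons t a) & Q (rcons t a)) ->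
  exists x, forall t, cone t x -> Q t.
Proof.
move=> Q0 Qstep.
(* Asking for [Q] at all initial segments makes a leaf with [Q'] a finished branch. *)
pose Q' t := nodes T t /\ forall u v, t = u ++ v -> Q u.
have Q'0 : Q' [::] by split; [exact: nodes_nil|case].
have Q'step t : Q' t -> ~ maxT T t -> exists a, Q' (rcons t a).
  move=> [Tt Qt] nm; have [a Ta Qa] := Qstep t Tt nm (Qt _ [::] (esym (cats0 _))).
  exists a; split=> // u v; case/lastP: v => [|v b]; first by rewrite cats0 => <-.
  by rewrite -rcons_cat => /rcons_inj[/Qt].
have [[s [ms [_ Qs]]]|nmax] := pselect (exists s, maxT T s /\ Q' s).
  have bs : inl s \in branch T by apply: mem_set.
  by exists (exist (fun z => z \in branch T) _ bs : branch_space T) => t [u /= E]; exact: Qs E.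
(* The choice function must be total; where [Q'] fails, the letter chosen at the root serves as a
   default. *)
have next t : exists a, Q' t -> Q' (rcons t a).
  have [Qt|nQt] := pselect (Q' t).
    have [mt|nm] := pselect (maxT T t); first by case: nmax; exists t.
    by have [a] := Q'step t Qt nm; exists a.
  have [mn|nm] := pselect (maxT T [::]); first by case: nmax; exists [::].
  by have [a _] := Q'step _ Q'0 nm; exists a.
have [c cP] := choice next.
pose b := fix b n := if n is m.+1 then rcons (b m) (c (b m)) else [::].
have mkb n : mkseq (fun n => c (b n)) n = b n.
  by elim: n => // n IHn; rewrite mkseqS IHn.
have Qb n : Q' (b n) by elim: n => //= n IHn; exact: cP.
have bh : inr (fun n => c (b n)) \in branch T.
  by apply: mem_set => n /=; rewrite mkb; case: (Qb n).
exists (exist (fun z => z \in branch T) _ bh : branch_space T) => t; rewrite /cone/= mkb => <-.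
by have [_ /(_ _ [::] (esym (cats0 _)))] := Qb (size t).
Qed.

(** Take the longest initial segment [s] of [t] that lies on [x]. Since [t] continues beyond [s],
    [s] is not a leaf, so [x] continues too, by a different letter. *)
Lemma cone_split t x : nodes T t -> ~ cone t x ->
  exists s a b v, [/\ t = rcons s a ++ v, cone (rcons s b) x & a <> b].
Proof.
elim/last_ind: t => [|t a IHt] Tt ntx; first by case: ntx; rewrite coneT.
have [tx|ntx'] := pselect (cone t x).
  have [|b bx] := cone_child _ tx; first by move=> /maxT_rcons; apply; exact: Tt.
  by exists t, a, b, [::]; split; rewrite ?cats0// => ab; apply: ntx; rewrite ab.
have [|s [a' [b [v [E bx ab]]]]] := IHt _ ntx'.
  by apply: (@tree_prefix _ T _ [:: a]); rewrite cats1.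
by exists s, a', b, (rcons v a); split=> //; rewrite E rcons_cat.
Qed.

(** * The lexicographic order of cones *)

Section lexicographic.
Variable e : seq A -> nat.
Hypothesis e_inj : forall s t, nodes T s -> nodes T t -> e s = e t -> s = t.

(** Only the node at which the paths part is related to [t], not its extensions: its cone already
    holds all branches that leave there. Siblings are compared by the codes of the nodes, since it
    is nodes that are enumerated. *)
Definition lex_lt u t : Prop := exists s a b v,
  [/\ u = rcons s a, t = rcons s b ++ v & (e (rcons s a) < e (rcons s b))%N].

Definition left_of t : set (branch_space T) :=
  \bigcup_(u in [set u | nodes T u /\ lex_lt u t]) cone u.

(** These sets climb from the empty set to the cone of a nonmaximal [t], adding at most one child
    per step when [e] is injective on nodes. They cut the interval of [t] into those of its
    children. *)
Definition children_below t n : set (branch_space T) :=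
  \bigcup_(u in [set u | nodes T u /\
     exists2 a, u = rcons t a & (e u < n)%N]) cone u.

Lemma left_of_nil : left_of [::] = set0.
Proof.
by apply/seteqP; split=> // x [u [_ [s [a [b [v [_ + _]]]]]]]; case: s.
Qed.

Lemma left_of_rcons t a :
  left_of (rcons t a) = left_of t `|` children_below t (e (rcons t a)).
Proof.
apply/seteqP; split=> x.
  move=> [u [Tu [s [b [c [v [ub + bc]]]]]] ux].
  case/lastP: v => [|v d].
    rewrite cats0 => /rcons_inj[ts ac]; subst t c; right.
    by exists u => //; split=> //; exists b; rewrite ?ub.
  rewrite -rcons_cat => /rcons_inj[ts _]; left.
  by exists u => //; split=> //; exists s, b, c, v.
move=> [[u [Tu [s [b [c [v [ub E bc]]]]]] ux]|[u [Tu [b E lt]] ux]].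
  exists u => //; split=> //; exists s, b, c, (rcons v a); split=> //.
  by rewrite E rcons_cat.
exists u => //; split=> //; exists t, b, a, [::]; rewrite cats0 -E; split=> //.
Qed.

Lemma left_of_disjoint t : left_of t `&` cone t = set0.
Proof.
apply/seteqP; split=> // x [[u [Tu [s [a [b [v [-> -> ab]]]]]] ux] tx].
have := cone_rcons_inj ux (cone_catl tx) => E.
by move: ab; rewrite E ltnn.
Qed.

(** In terms of intervals: right endpoints do not increase when a node is extended. *)
Lemma left_of_cat t v : left_of (t ++ v) `|` cone (t ++ v) `<=` left_of t `|` cone t.
Proof.
elim/last_ind: v => [|v a IHv]; first by rewrite cats0.
apply: subset_trans IHv; rewrite -rcons_cat left_of_rcons => x [[|]|].
- by left.
- by move=> [_ [_ [b -> _]] ux]; right; apply: (@cone_catl _ [:: b]); rewrite cats1.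
- by move=> ux; right; apply: (@cone_catl _ [:: a]); rewrite cats1.
Qed.

(** In terms of intervals: that of [u] ends before that of [t] begins. A branch to the left of [u]
    leaves the path to [t] either above the splitting node [s], or at [s] through a sibling with a
    still smaller code. *)
Lemma lex_lt_left u t : nodes T u -> lex_lt u t ->
  left_of u `|` cone u `<=` left_of t.
Proof.
move=> Tu ut x [|ux]; last by exists u.
move: ut Tu => [s [a [b [v [-> -> ab]]]]] Tu; rewrite left_of_rcons.
case=> [[w [Tw [s' [a' [b' [v' [wa' E ab']]]]]] wx]|[w [Tw [c E ca]] wx]].
  exists w => //; split=> //; exists s', a', b', (v' ++ b :: v); split=> //.
  by rewrite E -cats1 -!catA.
exists w => //; split=> //; exists s, c, b, v; split=> //.
by rewrite -E (ltn_trans ca).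
Qed.

(** Where [x] leaves [t], injectivity of [e] strictly orders the two siblings. The one on [x] is the
    [u] sought, and its interval is disjoint from that of [t]. *)
Lemma cone_lexP t x : nodes T t -> ~ cone t x -> exists2 u, cone u x &
  left_of u `|` cone u `<=` left_of t \/ left_of t `|` cone t `<=` left_of u.
Proof.
move=> Tt ntx; have [s [a [b [v [E bx ab]]]]] := cone_split Tt ntx.
have Ta : nodes T (rcons s a) by apply: (@tree_prefix _ T _ v); rewrite -E.
have Tb := cone_nodes bx; exists (rcons s b) => //.
have [lt|gt|/(e_inj Tb Ta)/rcons_inj[ba]] := ltngtP (e (rcons s b)) (e (rcons s a)).
- by left; apply: lex_lt_left => //; exists s, b, a, v.
- right; rewrite E; apply: (subset_trans (@left_of_cat _ _)).
  by apply: lex_lt_left => //; exists s, a, b, [::]; rewrite cats0.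
- by case: ab.
Qed.

Lemma children_below0 t : children_below t 0 = set0.
Proof. by apply/seteqP; split=> // x [u [_ [a]]]. Qed.

Lemma children_below_bigcup t : ~ maxT T t ->
  \bigcup_n children_below t n = cone t.
Proof.
move=> nm; apply/seteqP; split=> x.
  by move=> [n _ [_ [_ [a -> _]] ux]]; apply: (@cone_catl _ [:: a]); rewrite cats1.
move=> /(cone_child nm)[a ax]; exists (e (rcons t a)).+1 => //.
by exists (rcons t a) => //; split; [exact: cone_nodes ax|exists a].
Qed.

Lemma children_below_homo t : {homo children_below t : m n / (m <= n)%N >-> m `<=` n}.
Proof.
move=> m n mn x [u [Tu [a E um]] ux]; exists u => //; split=> //.
by exists a => //; exact: leq_trans um mn.
Qed.

Lemma children_belowS t a : nodes T (rcons t a) ->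
  children_below t (e (rcons t a)).+1 =
  children_below t (e (rcons t a)) `|` cone (rcons t a).
Proof.
move=> Ta; apply/seteqP; split=> x.
  move=> [u [Tu [b E]]]; rewrite ltnS leq_eqVlt => /orP[/eqP/(e_inj Tu Ta) <-|lt] ux; first by right.
  by left; exists u => //; split=> //; exists b.
case; first exact: children_below_homo.
by move=> ax; exists (rcons t a) => //; split=> //; exists a.
Qed.

Lemma children_below_empty t n :
  (forall a, nodes T (rcons t a) -> e (rcons t a) <> n) ->
  children_below t n.+1 = children_below t n.
Proof.
move=> nn; apply/seteqP; split; last exact: children_below_homo.
move=> x [u [Tu [b E]]]; rewrite ltnS leq_eqVlt => /orP[/eqP eu|lt] ux.
  by case: (nn b); rewrite -E.
by exists u => //; split=> //; exists b.
Qed.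

End lexicographic.
End cones.

(** * Cones as generators of the Borel sets *)

Lemma countable_bigcup_measurable d (X : measurableType d) (I : Type) (D : set I)
    (F : I -> set X) : countable D -> (forall i, D i -> measurable (F i)) ->
  measurable (\bigcup_(i in D) F i).
Proof.
move=> cD mF; rewrite bigcup_set_type; apply: countable_bigcupT_measurable.
  by apply: sub_countable cD; move: (card_setT D) => /card_eqPle[].
by move=> i; apply: mF; exact: set_mem (valP i).
Qed.

Section borel_cones.
Variables (A : Type) (T : tree A).
Hypothesis T_countable : countable (nodes T).
Local Notation cone := (@Defs.cone A T).

Lemma open_cone t : nodes T t -> open (cone t).
Proof.
move=> Tt; exists [set cone t]; last by rewrite bigcup_set1.
move=> _ ->; exists (fset1 (cone t)); last by rewrite set_fset1 bigcap_set1.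
by move=> B; rewrite !inE => ->; exists t.
Qed.

Lemma measurable_cone t : measurable (cone t : set (branch_borel T)).
Proof.
have [Tt|nTt] := pselect (nodes T t); first by apply: sub_sigma_algebra; exact: open_cone.
rewrite (_ : cone t = set0); first exact: measurable0.
by apply/seteqP; split=> // x /cone_nodes.
Qed.

Lemma measurable_bigcup_cone (N : set (seq A)) : N `<=` nodes T ->
  measurable (\bigcup_(t in N) cone t : set (branch_borel T)).
Proof.
move=> NT; apply: countable_bigcup_measurable => [|t _].
  exact: sub_countable (subset_card_le NT) T_countable.
exact: measurable_cone.
Qed.

(** The subbase of cones is a base: of two cones containing [x], the one with the longer node lies
    inside the other, so a finite intersection around [x] contains a single cone around [x]. *)
Lemma open_cone_nbhs (U : set (branch_space T)) x : open U -> U x ->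
  exists2 t, cone t x & cone t `<=` U.
Proof.
move=> [F FI <-] [C FC Cx]; have [B BT BC] := FI _ FC; rewrite -BC in Cx.
suff H (l : seq (set (branch_space T))) :
    (forall C, C \in l -> [set cone t | t in nodes T] C /\ C x) ->
    exists2 t, cone t x & forall C, C \in l -> cone t `<=` C.
  have [D DB|t tx tB] := H (enum_fset B).
    by split; [exact/set_mem/BT|exact: Cx].
  exists t => // y ty; have Cy : C y by rewrite -BC => D DB; exact: tB ty.
  by exists C.
move=> {C FC BC Cx}; elim: l => [_|C l IHl Cl]; first by exists [::] => //; rewrite coneT.
have [D Dl|t tx tl] := IHl; first by apply: Cl; rewrite inE Dl orbT.
have [[u Tu uC] Cx] := Cl C (mem_head _ _); subst C.
have [tu|/ltnW ut] := leqP (size t) (size u).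
  have [v E] := cone_comparable tx Cx tu; exists u => // D.
  rewrite inE => /orP[/eqP -> //|/tl]; apply: subset_trans.
  by rewrite E; exact: cone_catl.
have [v E] := cone_comparable Cx tx ut; exists t => // D.
by rewrite inE => /orP[/eqP ->|/tl //]; rewrite E; exact: cone_catl.
Qed.

(** The empty set is included to close the family under intersection, as two cones are either nested
    or disjoint. *)
Definition cones : set (set (branch_borel T)) :=
  [set C | C = set0 \/ exists2 t, nodes T t & C = cone t].

(** An open set is the union of the cones inside it, and there are only countably many cones. *)
Lemma borel_cones : measurable = <<s cones >>.
Proof.
apply/seteqP; split; apply: smallest_sub; try exact: smallest_sigma_algebra.
  move=> U oU.
  rewrite (_ : U = \bigcup_(t in [set t | nodes T t /\ cone t `<=` U]) cone t).
    apply: (@countable_bigcup_measurable _ (g_sigma_algebraType cones)).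
      by apply: sub_countable T_countable; apply: subset_card_le => t [].
    by move=> t [Tt _]; apply: sub_sigma_algebra; right; exists t.
  apply/seteqP; split=> [x Ux|x [t [_ tU] tx]]; last exact: tU.
  have [t tx tU] := open_cone_nbhs oU Ux.
  by exists t => //; split=> //; exact: cone_nodes tx.
move=> _ [->|[t _ ->]]; [exact: measurable0|exact: measurable_cone].
Qed.

Lemma setI_closed_cones : setI_closed cones.
Proof.
move=> _ _ [->|[t Tt ->]] [->|[u Tu ->]]; rewrite ?setI0 ?set0I; try by left.
have [/eqP ->|/set0P[x [tx ux]]] := boolP ((cone t `&` cone u) == set0); first by left.
right; have [tu|/ltnW ut] := leqP (size t) (size u).
  have [v E] := cone_comparable tx ux tu; exists u => //.
  by apply/setIidPr; rewrite E; exact: cone_catl.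
have [v E] := cone_comparable ux tx ut; exists t => //.
by apply/setIidPl; rewrite E; exact: cone_catl.
Qed.

Lemma measure_cone_unique (R : realType)
    (m m' : measure (branch_borel T) R) :
    (forall t, nodes T t -> m (cone t) = m' (cone t)) ->
    (m setT < +oo)%E ->
  forall B, measurable B -> m B = m' B.
Proof.
move=> mm' moo; apply: (measure_unique cones (fun _ => setT)).
- exact: borel_cones.
- exact: setI_closed_cones.
- by move=> _; right; exists [::]; [exact: nodes_nil|rewrite coneT].
- by rewrite bigcup_const//; exists 0%N.
- by move=> _ [->|[t Tt ->]]; [rewrite !measure0|exact: mm'].
- by [].
Qed.

(** The cone of a leaf is already a singleton. Otherwise the cones along [x] decrease to [[set x]],
    which is null by freeness, and continuity from above applies. *)
Lemma free_cone_small (R : realType) (lambda : probability (branch_borel T) R) x r :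
    free_measure lambda -> (0 < r)%R ->
  exists2 t, cone t x & (lambda (cone t) < r%:E)%E.
Proof.
move=> free r0; have [mx lx] := free x.
have [[t [mt tx]]|nm] := pselect (exists t, maxT T t /\ cone t x).
  exists t => //; rewrite (_ : cone t = [set x]) ?lx//.
  by apply/seteqP; split=> [y ty|y ->//]; exact: cone_maxT mt ty tx.
have x0 : cone [::] x by rewrite coneT.
have next t : exists a, cone t x -> cone (rcons t a) x.
  have [tx|ntx] := pselect (cone t x).
    have [|a ax] := cone_child _ tx; last by exists a.
    by move=> mt; case: nm; exists t.
  have [|a _] := cone_child _ x0; last by exists a.
  by move=> mt; case: nm; exists [::].
have [c cP] := choice next.
pose b := fix b n := if n is m.+1 then rcons (b m) (c (b m)) else [::].
have bx n : cone (b n) x by elim: n => [|n /cP//].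
have sb n : size (b n) = n by elim: n => //= n IHn; rewrite size_rcons IHn.
have cb : \bigcap_n cone (b n) = [set x].
  apply/seteqP; split=> [y yb|y -> //]; apply: cone_separates => t.
  (* The initial segments of such a [z] are exactly the nodes [b n], so [z] and [x] lie in the same
     cones. *)
  have bz z : (forall n, cone (b n) z) -> cone t z <-> b (size t) = t.
    move=> zb; split=> [tz|E]; last by rewrite -E.
    have [v E] := cone_comparable tz (zb (size t)) (eq_leq (esym (sb _))).
    have := congr1 (take (size t)) E.
    by rewrite take_size_cat// take_oversize ?sb.
  by rewrite !bz// => n; exact: yb.
have [//|nn] := pselect (exists2 t, cone t x & (lambda (cone t) < r%:E)%E).
have mb n : measurable (cone (b n) : set (branch_borel T)) by exact: measurable_cone.
have cvg_b : (lambda \o (fun n => cone (b n))) n @[n --> \oo] --> 0%E.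
  rewrite -lx -cb; apply: nonincreasing_cvg_mu => //.
  - by rewrite -ge0_fin_numE ?fin_num_measure.
  - by rewrite cb.
  - apply/nonincreasing_seqP => n; apply/subsetPset => /=.
    by rewrite -cats1; exact: cone_catl.
have : (r%:E <= 0)%E.
  rewrite -(cvg_lim _ cvg_b)//; apply: lime_ge; first by apply/cvg_ex; exists 0%E.
  apply: nearW => n; rewrite leNgt; apply/negP => lt; apply: nn; by exists (b n).
by rewrite lee_fin leNgt r0.
Qed.
End borel_cones.

(** * The intervals attached to nodes and the map from reals to branches *)

Section branch_intervals.
Variables (R : realType) (A : Type) (T : tree A).
Variables (lambda : probability (branch_borel T) R) (e : seq A -> nat).
Hypothesis T_countable : countable (nodes T).
Hypothesis e_inj : forall s t, nodes T s -> nodes T t -> e s = e t -> s = t.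
Local Notation cone := (@Defs.cone A T).
Local Notation left_of := (@left_of A T e).
Local Notation children_below := (@children_below A T e).

(** This is the interval [J t]; it is half-open so that consecutive siblings share no endpoint. *)
Definition branch_itv (t : seq A) : set R :=
  [set y | (lambda (left_of t) <= y%:E < lambda (left_of t `|` cone t))%E].

Lemma measurable_left_of t : measurable (left_of t : set (branch_borel T)).
Proof. by apply: measurable_bigcup_cone => // u []. Qed.

Lemma measurable_children_below t n :
  measurable (children_below t n : set (branch_borel T)).
Proof. by apply: measurable_bigcup_cone => // u []. Qed.

Lemma measurable_left_of_cone t :
  measurable (left_of t `|` cone t : set (branch_borel T)).
Proof. by apply: measurableU; [exact: measurable_left_of|exact: measurable_cone]. Qed.

Lemma branch_itv_nil y : branch_itv [::] y <-> (0 <= y < 1)%R.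
Proof.
rewrite /branch_itv/= left_of_nil set0U coneT measure0 probability_setT.
by rewrite lee_fin lte_fin.
Qed.

(** By continuity from below, the measures of the sets [D n] increase to the right endpoint of the
    interval of [t], hence exceed [y] at some stage. The first such stage singles out the child. *)
Lemma branch_itv_child t y : ~ maxT T t -> branch_itv t y ->
  exists2 a, nodes T (rcons t a) & branch_itv (rcons t a) y.
Proof.
move=> nm /andP[ly yl].
pose D n : set (branch_borel T) := left_of t `|` children_below t n.
have mD n : measurable (D n).
  by apply: measurableU; [exact: measurable_left_of|exact: measurable_children_below].
have UD : \bigcup_n D n = left_of t `|` cone t.
  rewrite bigcupU bigcup_const; last by exists 0%N.
  by rewrite children_below_bigcup.
have D_cvg : (lambda \o D) n @[n --> \oo] --> lambda (left_of t `|` cone t).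
  rewrite -UD; apply: nondecreasing_cvg_mu => //.
    by rewrite UD; exact: measurable_left_of_cone.
  by move=> m n mn; apply/subsetPset; apply: setUS; exact: children_below_homo.
have [n Dn] : exists n, (y%:E < lambda (D n))%E.
  apply: contrapT => nD; move: yl; apply/negP; rewrite -leNgt.
  rewrite -(cvg_lim _ D_cvg)//; apply: lime_le; first by apply/cvg_ex; eexists; exact: D_cvg.
  by apply: nearW => n; rewrite leNgt; apply/negP => Dn; apply: nD; exists n.
(* y falls between the steps m and m.+1, so some child is numbered m *)
have [[|m] Dm minm] := ex_minnP (ex_intro (fun n => (y%:E < lambda (D n))%E) n Dn).
  by move: Dm; rewrite /D children_below0 setU0 ltNge ly.
have lm : (lambda (D m) <= y%:E)%E.
  by rewrite leNgt; apply/negP => /minm; rewrite ltnn.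
have [[a [Ta ea]]|na] := pselect (exists a, nodes T (rcons t a) /\ e (rcons t a) = m).
  exists a => //; rewrite /branch_itv/= left_of_rcons ea lm/=.
  by rewrite -setUA -ea -children_belowS// ea.
move: Dm; rewrite /D children_below_empty; first by rewrite ltNge -/(D m) lm.
by move=> a Ta ea; apply: na; exists a.
Qed.

(** For a node [t] off [x], [cone_lexP] yields a node of [x] whose interval is disjoint from that of
    [t]. As [y] lies in the former, it cannot lie in the latter. *)
Lemma cone_branch_itv x y : (forall t, cone t x -> branch_itv t y) ->
  forall t, nodes T t -> cone t x <-> branch_itv t y.
Proof.
move=> xy t Tt; split=> [/xy //|/andP[ly yl]]; apply: contrapT => ntx.
have [u /xy/andP[lu ul] [ut|tu]] := cone_lexP e_inj Tt ntx.
  move: ul; apply/negP; rewrite -leNgt; apply: le_trans ly.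
  by apply: le_measure => //; rewrite inE;
    [exact: measurable_left_of_cone|exact: measurable_left_of].
move: yl; apply/negP; rewrite -leNgt; apply: le_trans lu.
by apply: le_measure => //; rewrite inE;
  [exact: measurable_left_of_cone|exact: measurable_left_of].
Qed.

Lemma branch_itvE t : branch_itv t =
  `[fine (lambda (left_of t)), fine (lambda (left_of t `|` cone t))[%classic.
Proof.
have ml := measurable_left_of t; have mlc := measurable_left_of_cone t.
apply/seteqP; split=> y; rewrite /branch_itv/= in_itv/= -lee_fin -lte_fin;
  by rewrite !fineK ?fin_num_measure.
Qed.

Lemma measurable_branch_itv t : measurable (branch_itv t).
Proof. by rewrite branch_itvE; exact: measurable_itv. Qed.

Lemma lebesgue_branch_itv t : lebesgue_measure (branch_itv t) = lambda (cone t).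
Proof.
have ml := measurable_left_of t; have mc := @measurable_cone A T t.
have mlc := measurable_left_of_cone t.
have lU : lambda (left_of t `|` cone t) = (lambda (left_of t) + lambda (cone t))%E.
  by apply: measureU => //; exact: left_of_disjoint.
rewrite branch_itvE lebesgue_measure_itv/= lte_fin lU fineD ?fin_num_measure//.
rewrite ltrDl; case: ltP => [_|].
  by rewrite -EFinB addrAC subrr add0r fineK ?fin_num_measure.
(* In the degenerate case the interval is empty, and the cone has measure at most 0. *)
move=> c0; apply/esym/eqP; rewrite eq_le measure_ge0 andbT.
by rewrite -[lambda _]fineK ?fin_num_measure// lee_fin.
Qed.

Lemma branch_itv_sub01 t : branch_itv t `<=` `[0%R, 1%R[%classic.
Proof.
move=> y /andP[ly yl]; rewrite /= in_itv/= -lee_fin (le_trans _ ly)//=.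
rewrite -lte_fin (lt_le_trans yl)// probability_le1//.
exact: measurable_left_of_cone.
Qed.

Lemma exists_branch_map : exists g : R -> branch_borel T,
  measurable_fun setT g /\
  forall y, (0 <= y < 1)%R -> forall t, nodes T t -> cone t (g y) <-> branch_itv t y.
Proof.
(* Outside [[0, 1)] the map takes the default value [point]. This adds the complement of [[0, 1)] to
   the preimage of each cone containing [point]. *)
have H y : exists x : branch_borel T,
    if (0 <= y < 1)%R then forall t, cone t x -> branch_itv t y else x = point.
  have [/branch_itv_nil y0|_] := boolP (0 <= y < 1)%R; last by exists point.
  by apply: exists_branch => // t _; exact: branch_itv_child.
have [g gP] := choice H.
have gJ y : (0 <= y < 1)%R ->
    forall t, nodes T t -> cone t (g y) <-> branch_itv t y.
  by move=> y01; apply: cone_branch_itv; have := gP y; rewrite y01.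
exists g; split=> //; apply: (measurability _ (borel_cones T_countable)).
move=> _ [_ [->|[t Tt ->]] <-]; rewrite ?preimage_set0 setTI//.
have [pt|npt] := pselect (cone t point).
  rewrite (_ : g @^-1` cone t = branch_itv t `|` ~` `[0%R, 1%R[%classic).
    by apply: measurableU; [exact: measurable_branch_itv|exact: measurableC].
  apply/seteqP; split=> y.
    have [y01 /(gJ y y01 _ Tt)|/negP y01 _] := boolP (0 <= y < 1)%R; first by left.
    by right; rewrite /= in_itv.
  case=> [yt|/=]; last first.
    by rewrite in_itv => /negP/negbTE y01; have := gP y; rewrite /preimage/= y01 => ->.
  by apply/(gJ y) => //; have := branch_itv_sub01 yt; rewrite /= in_itv.
rewrite (_ : g @^-1` cone t = branch_itv t); first exact: measurable_branch_itv.
apply/seteqP; split=> y; rewrite /preimage/=.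
  by have := gP y; case: ifPn => [y01 _ /(gJ y y01 _ Tt)//|_ -> /npt].
by move=> yt; apply/(gJ y) => //; have := branch_itv_sub01 yt; rewrite /= in_itv.
Qed.

(** The image under [g] of Lebesgue measure on [[0, 1)] agrees with [lambda] on cones, as the
    preimage of a cone is its interval; hence the two agree on all Borel sets. *)
Lemma branch_map_measure (g : R -> branch_borel T) :
    measurable_fun setT g ->
    (forall y, (0 <= y < 1)%R ->
      forall t, nodes T t -> cone t (g y) <-> branch_itv t y) ->
  forall B, measurable B -> lambda B = lebesgue_measure (`[0%R, 1%R[ `&` g @^-1` B).
Proof.
move=> mg gJ.
have m01 : measurable (`[0%R, 1%R[%classic : set R) by exact: measurable_itv.
pose m1 : measure _ R := mrestr lebesgue_measure m01.
pose m2 : measure _ R := pushforward m1 (g : measurableTypeR R -> _).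
move=> B mB; rewrite (@measure_cone_unique _ _ T_countable R lambda (m2 mg))//.
- by rewrite /m2/= /pushforward/= /m1/= /mrestr setIC.
- move=> t Tt; rewrite /m2/= /pushforward/= /m1/= /mrestr -lebesgue_branch_itv.
  congr (lebesgue_measure _); apply/seteqP; split=> y.
    by move=> yt; have := branch_itv_sub01 yt; split=> //; apply/(gJ y) => //; rewrite -in_itv.
  by move=> [/= ty]; rewrite in_itv/= => y01; apply/(gJ y).
- by rewrite -ge0_fin_numE ?fin_num_measure.
Qed.

End branch_intervals.

(** * Null sets under a pair of almost inverse maps *)

Lemma negligible_sub01 (R : realType) (N : set R) : N `<=` `[0%R, 1%R]%classic ->
  lebesgue_measure.-negligible (N `&` `[0%R, 1%R[%classic) ->
  null_ideal01 R N.
Proof.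
move=> N01 null; split=> //.
have sub : N `<=` N `&` `[0%R, 1%R[%classic `|` [set 1%R].
  move=> y Ny; have := N01 _ Ny; rewrite /= in_itv/= => /andP[y0].
  by rewrite le_eqVlt => /orP[/eqP|y1]; [right|left; rewrite in_itv/= y0].
apply: (negligibleS (mu := lebesgue_measure) sub).
apply: (negligibleU (mu := lebesgue_measure)) => //.
apply/(negligibleP lebesgue_measure); first exact: measurable_set1.
exact: lebesgue_measure_set1.
Qed.

Section almost_inverse.
Variables (R : realType) (d : measure_display) (X : measurableType d).
Variables (lambda : {measure set X -> \bar R}%R) (f : X -> R) (g : R -> X).
Hypotheses (mf : measurable_fun setT f) (mg : measurable_fun setT g).
Hypothesis f01 : forall x, (0 <= f x <= 1)%R.
Hypothesis fgK : forall y, (0 <= y < 1)%R -> f (g y) = y.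
Hypothesis lambdaE : forall B, measurable B ->
  lambda B = lebesgue_measure (`[0%R, 1%R[ `&` g @^-1` B).

Lemma set_ideal_null : set_ideal [set: X] (null_ideal lambda).
Proof.
split=> // [B C BC|B C]; first exact: negligibleS.
exact: negligibleU.
Qed.

Lemma set_ideal_null01 : set_ideal (unit_interval R) (null_ideal01 R).
Proof.
split=> [B []//|B C BC [C01 nC]|B C [B01 nB] [C01 nC]].
  by split; [exact: subset_trans C01|exact: (negligibleS (mu := lebesgue_measure)) nC].
by split; [move=> y [/B01|/C01]|exact: (negligibleU (mu := lebesgue_measure))].
Qed.

Lemma section_null01 :
  ideal_section [set: X] (unit_interval R) (null_ideal lambda) (null_ideal01 R) f g.
Proof.
split=> // [B [C [mC C0 BC]]|]; apply: negligible_sub01; try by move=> y [].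
  exists (`[0%R, 1%R[ `&` g @^-1` C); split; last by move=> y [[_ /BC gy]].
  - by apply: measurableI; [exact: measurable_itv|rewrite -[X in measurable X]setTI; exact: mg].
  - by rewrite -lambdaE.
apply: (negligibleS _ (negligible_set0 lebesgue_measure)) => y [[_ /= nfg]]; rewrite in_itv => y01.
by apply: nfg; exact: fgK.
Qed.

(** Since [f] inverts [g] on [[0, 1)], the preimage of [B] under [f] has measure at most that of
    [B]. The countable separating family [C] covers the points with [g (f x) <> x] by the measurable
    sets [E i], on each of which membership of [x] and of [g (f x)] in [C i] differs. *)
Lemma section_null (I : Type) (D : set I) (C : I -> set X) : countable D ->
    (forall i, D i -> measurable (C i)) ->
    (forall x y, (forall i, D i -> C i x <-> C i y) -> x = y) ->
  ideal_section (unit_interval R) [set: X] (null_ideal01 R) (null_ideal lambda) g f.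
Proof.
move=> cD mC Csep;
split=> [x _|N [_ [B [mB B0 NB]]]|].
- by rewrite /unit_interval/= in_itv/= f01.
- exists (f @^-1` B); split; last by move=> x [_ /NB].
    by rewrite -[X in measurable X]setTI; exact: mf.
  rewrite lambdaE; last by rewrite -[X in measurable X]setTI; exact: mf.
  apply/eqP; rewrite -measure_le0 -B0; apply: le_measure; rewrite ?inE//.
    apply: measurableI; first exact: measurable_itv.
    rewrite -[X in measurable X]setTI; apply: mg => //.
    by rewrite -[X in measurable X]setTI; exact: mf.
  by move=> y [/=]; rewrite in_itv => y01; rewrite fgK.
have mgf : measurable_fun setT (g \o f) by exact: measurableT_comp.
have mE i : D i -> measurable ((g \o f) @^-1` C i).
  by move=> Di; rewrite -[X in measurable X]setTI; apply: mgf => //; exact: mC.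
pose E i := (C i `\` (g \o f) @^-1` C i) `|` ((g \o f) @^-1` C i `\` C i).
have mEi i : D i -> measurable (E i).
  by move=> Di; apply: measurableU; apply: measurableD; [exact: mC|exact: mE|exact: mE|exact: mC].
have mUE : measurable (\bigcup_(i in D) E i) by exact: countable_bigcup_measurable.
(* E i misses the range of g, as f is a left inverse of g *)
exists (\bigcup_(i in D) E i); split=> //.
  rewrite lambdaE// (_ : _ `&` _ = set0) ?measure0//.
  apply/seteqP; split=> // y [/=]; rewrite in_itv => y01 [i Di].
  by rewrite /E /preimage/= fgK//; case=> -[].
move=> x [_ /= gfx]; apply: contrapT => nE; apply: gfx; apply: Csep => i Di.
apply: contrapT => nC; apply: nE; exists i => //.
have [Cx|nCx] := pselect (C i x); [left|right]; split=> //=.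
- by move=> Cgf; apply: nC.
- by apply: contrapT => nCgf; apply: nC.
Qed.

End almost_inverse.

(** * The position of a branch in the unit interval *)

Section branch_inverse.
Variables (R : realType) (A : Type) (T : tree A).
Variables (lambda : probability (branch_borel T) R) (e : seq A -> nat).
Hypothesis T_countable : countable (nodes T).
Local Notation cone := (@Defs.cone A T).
Local Notation left_of := (@left_of A T e).

Definition branch_pos (x : branch_borel T) : R :=
  sup [set fine (lambda (left_of t)) | t in [set t | cone t x]].

Let left01 t : (0 <= fine (lambda (left_of t)) <= 1)%R.
Proof.
rewrite fine_ge0// -lee_fin fineK ?fin_num_measure//; last exact: measurable_left_of.
by rewrite probability_le1//; exact: measurable_left_of.
Qed.

Let branch_pos_sup x : has_sup [set fine (lambda (left_of t)) | t in [set t | cone t x]].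
Proof.
split; last by exists 1%R => _ [t _ <-]; case/andP: (left01 t).
by exists (fine (lambda (left_of [::]))), [::] => //=; rewrite coneT.
Qed.

Lemma branch_pos01 x : (0 <= branch_pos x <= 1)%R.
Proof.
apply/andP; split; last first.
  by apply: ge_sup => [|_ [t _ <-]]; [case: (branch_pos_sup x)|case/andP: (left01 t)].
have [l0 _] := andP (left01 [::]); apply: le_trans l0 _.
apply: ub_le_sup; first by case: (branch_pos_sup x).
by exists [::] => //=; rewrite coneT.
Qed.

(** A supremum exceeds [r] exactly when one of its terms does, so the preimage of an open upper ray
    is a countable union of cones. *)
Lemma measurable_branch_pos : measurable_fun setT branch_pos.
Proof.
apply: (measurability _ (measurable_realfun.RGenOInfty.measurableE R)).
move=> _ [_ [r ->] <-]; rewrite setTI.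
rewrite (_ : _ @^-1` _ = \bigcup_(t in
    [set t | nodes T t /\ (r < fine (lambda (left_of t)))%R]) cone t).
  by apply: measurable_bigcup_cone => // t [].
apply/seteqP; split=> x; rewrite /preimage/= in_itv/= andbT.
  move=> /sup_gt[|_ [t tx <-] rt]; first by case: (branch_pos_sup x).
  by exists t => //; split=> //; exact: cone_nodes tx.
move=> [t [_ rt] tx]; apply: lt_le_trans rt _.
by apply: ub_le_sup; [case: (branch_pos_sup x)|exists t].
Qed.

(** All left endpoints along [x] are at most [y], so the supremum is too. If it fell short of [y], a
    cone around [x] of measure below the gap would have its right endpoint at or below [y]. *)
Lemma branch_posP x y : free_measure lambda ->
  (forall t, cone t x -> branch_itv lambda e t y) -> branch_pos x = y.
Proof.
move=> free xy; have fl t : lambda (left_of t) \is a fin_num.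
  by apply: fin_num_measure; exact: measurable_left_of.
apply/eqP; rewrite eq_le; apply/andP; split.
  apply: ge_sup => [|_ [t /xy/andP[ly _] <-]]; first by case: (branch_pos_sup x).
  by rewrite -lee_fin fineK.
rewrite leNgt; apply/negP => lt.
have d0 : (0 < y - branch_pos x)%R by rewrite subr_gt0.
have [t tx lt'] := free_cone_small x free d0.
have /andP[_] := xy t tx; apply/negP; rewrite -leNgt.
rewrite measureU; [|exact: measurable_left_of|exact: measurable_cone|exact: left_of_disjoint].
have lp : (lambda (left_of t) <= (branch_pos x)%:E)%E.
  rewrite -[lambda _]fineK// lee_fin.
  by apply: ub_le_sup; [case: (branch_pos_sup x)|exists t].
apply: le_trans (leeD lp (ltW lt')) _.
by rewrite -EFinD lee_fin addrC subrK.
Qed.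

End branch_inverse.

Theorem theoremC (R : realType) (A : Type) (P : prob_tree A R)
    (lambda : probability (branch_borel P) R) :
  tree_measure lambda ->
  free_measure lambda ->
  [/\ add_ideal (null_ideal lambda) = add_ideal (null_ideal01 R),
      cov_ideal [set: branch_borel P] (null_ideal lambda) =
        cov_ideal (unit_interval R) (null_ideal01 R),
      non_ideal [set: branch_borel P] (null_ideal lambda) =
        non_ideal (unit_interval R) (null_ideal01 R) &
      cof_ideal (null_ideal lambda) = cof_ideal (null_ideal01 R)].
Proof.
move=> _ free; have cP := ptree_countable P.
have /countable_injP[e e_injP] := cP.
have e_inj s t : nodes P s -> nodes P t -> e s = e t -> s = t.
  by move=> Ps Pt; apply: e_injP; exact: mem_set.
have [g [mg gJ]] := exists_branch_map lambda cP e_inj.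
have fgK y : (0 <= y < 1)%R -> branch_pos lambda e (g y) = y.
  move=> y01; apply: branch_posP => // t ty; apply/(gJ y y01) => //.
  exact: cone_nodes ty.
have mf := measurable_branch_pos lambda e cP.
have f01 := branch_pos01 lambda e cP.
have lambdaE := branch_map_measure cP mg gJ.
apply: (@ideal_section_invariants _ _ _ _ _ _ (branch_pos lambda e) g).
- exact: set_ideal_null.
- exact: set_ideal_null01.
- exact: section_null01.
(* The cones of the nodes form the countable separating family. *)
- apply: (section_null mf mg f01 fgK lambdaE cP (C := @cone A P)).
  + by move=> t _; exact: measurable_cone.
  + move=> x y xy; apply: cone_separates => t.
    by split=> h; apply/(xy t) => //; exact: cone_nodes h.
Qed.
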